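(* Let $n\geq k$ be positive integers with $n$ sufficiently large (in terms of $k$). Then the following hold. (a) \[q(n,2,k)=\left\lceil\frac{2(n-1)}{k}\right\rceil.\] (b) \[\left\lceil\frac{3n-2}{k+3}\right\rceil\;\leq\; q(n,3,k)\;\leq\;\left\lceil\frac{3n}{k}\right\rceil+2.\]
   Context: Write $[n]=\{1,\dots,n\}$. A family $\mathcal{A}$ of subsets of $[n]$ is called $d$-separating if for any two distinct sets $D_1,D_2\subset[n]$, each of size exactly $d$, there is a member $A\in\mathcal{A}$ such that either $A\cap D_1\neq\emptyset$ and $A\cap D_2=\emptyset$, or $A\cap D_1=\emptyset$ and $A\cap D_2\neq\emptyset$. The members of $\mathcal{A}$ are called queries. $q(n,d,k)$ denotes the minimum number of queries, each a subset of $[n]$ of size at most $k$, needed to determine non-adaptively an unknown defective set $Y\subset[n]$ of size exactly $d$ (a query $A$ is answered positively if and only if $A\cap Y\neq\emptyset$, and all queries are fixed in advance). Equivalently, $q(n,d,k)$ is the minimum size of a $d$-separating family of subsets of $[n]$ all of whose members have size at most $k$.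
   Formalization: Part (a) is stated only for k ≥ 2: for k = 1 the formula is false, since querying all but one of the singletons is 2-separating, so q(n,2,1) ≤ n−1 < 2(n−1) for every n ≥ 2. *)

(* Defs.v *)
From mathcomp Require Import all_boot.

Set Implicit Arguments.
Unset Strict Implicit.
Unset Printing Implicit Defensive.

(* The ground set [n] is represented by 'I_n, i.e. {0, ..., n-1}. *)

Definition separates n (A D1 D2 : {set 'I_n}) : bool :=
  (A :&: D1 != set0) && (A :&: D2 == set0)
  || (A :&: D1 == set0) && (A :&: D2 != set0).

Definition separating n d (F : {set {set 'I_n}}) : bool :=
  [forall D1 : {set 'I_n}, forall D2 : {set 'I_n},
    [&& #|D1| == d, #|D2| == d & D1 != D2] ==>
    [exists A in F, separates A D1 D2]].

Definition admissible n d k (F : {set {set 'I_n}}) : bool :=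
  separating d F && [forall A in F, #|A| <= k].

Definition singletons n : {set {set 'I_n}} := [set [set x] | x : 'I_n].

(* The singletons only serve as the default value of the arg min; they are
   admissible as soon as 0 < k (lemma admissible_singletons), so that q n d k is
   then a genuine minimum (lemma qP).  The value is meaningless for k = 0. *)
Definition q (n d k : nat) : nat :=
  #|[arg min_(F < singletons n | admissible d k F) #|F|]|.

Lemma separatingP n d (F : {set {set 'I_n}}) :
  reflect (forall D1 D2 : {set 'I_n}, #|D1| = d -> #|D2| = d -> D1 <> D2 ->
             exists2 A, A \in F & separates A D1 D2)
          (separating d F).
Proof.
apply: (iffP forallP) => [sF D1 D2 d1 d2 /eqP nD | sF D1].
  by have /forallP/(_ D2)/implyP := sF D1; rewrite d1 d2 eqxx nD => /(_ isT)/exists_inP.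
apply/forallP => D2; apply/implyP => /and3P[/eqP d1 /eqP d2 /eqP nD].
by apply/exists_inP/sF.
Qed.

(* A family is d-separating iff the vector of answers to its queries determines
   the defective set among all sets of size d. *)
Lemma separating_inj n d (F : {set {set 'I_n}}) :
  separating d F <->
  {in [pred D : {set 'I_n} | #|D| == d] &,
     injective (fun D => [set A in F | A :&: D != set0])}.
Proof.
split=> [/separatingP sF D1 D2 /eqP d1 /eqP d2 /setP eqD | inj].
  apply/eqP/negPn/negP => /eqP nD; have [A AF] := sF _ _ d1 d2 nD.
  have := eqD A; rewrite !inE AF /separates /=.
  by do 2 case: (_ == set0).
apply/separatingP => D1 D2 d1 d2 nD.
have {}d1 : D1 \in [pred D : {set 'I_n} | #|D| == d] by rewrite inE d1.
have {}d2 : D2 \in [pred D : {set 'I_n} | #|D| == d] by rewrite inE d2.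
have /eqP neq : [set A in F | A :&: D1 != set0] <> [set A in F | A :&: D2 != set0].
  by move=> /(inj _ _ d1 d2).
have [A] : exists A, (A \in [set A in F | A :&: D1 != set0])
                     != (A \in [set A in F | A :&: D2 != set0]).
  apply/existsP; apply: contraNT neq; rewrite negb_exists => /forallP h.
  by apply/eqP/setP => A; apply/eqP; rewrite -[_ == _]negbK h.
rewrite !inE; case AF: (A \in F) => //= sA; exists A => //.
by move: sA; rewrite /separates; do 2 case: (_ == set0).
Qed.

Lemma separates1 n (x : 'I_n) (D1 D2 : {set 'I_n}) :
  (x \in D1) != (x \in D2) -> separates [set x] D1 D2.
Proof.
have E (D : {set 'I_n}) : ([set x] :&: D == set0) = (x \notin D).
  by rewrite setI_eq0 disjoints1.
by rewrite /separates !E; do 2 case: (x \in _).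
Qed.

Lemma admissible_singletons n d k : 0 < k -> admissible d k (singletons n).
Proof.
move=> k0; apply/andP; split; last first.
  by apply/forall_inP => A /imsetP[x _ ->]; rewrite cards1.
apply/separatingP => D1 D2 _ _ /eqP nD.
have [x nx] : exists x, (x \in D1) != (x \in D2).
  apply/existsP; apply: contraNT nD; rewrite negb_exists => /forallP h.
  by apply/eqP/setP => x; apply/eqP; rewrite -[_ == _]negbK h.
by exists [set x]; [exact: imset_f | exact: separates1].
Qed.

Lemma qP n d k : 0 < k ->
  (exists2 F : {set {set 'I_n}}, admissible d k F & #|F| = q n d k) /\
  (forall F : {set {set 'I_n}}, admissible d k F -> q n d k <= #|F|).
Proof.
move=> k0; rewrite /q; case: arg_minnP; first exact: admissible_singletons.
by move=> F aF minF; split; [exists F | ].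
Qed.

(* With singleton queries one element need not be tested, so that
   q(n,2,1) = n - 1 < 2(n - 1) for n >= 2: the formula for q(n,2,k) can hold
   only for k >= 2. *)
Lemma q_1_le n d : q n.+1 d 1 <= n.
Proof.
have [_ /(_ (singletons n.+1 :\ [set ord0]))] := @qP n.+1 d 1 isT.
have -> : #|singletons n.+1 :\ [set ord0]| = n.
  have := cardsD1 [set ord0] (singletons n.+1).
  rewrite imset_f // card_imset ?card_ord; last exact: set1_inj.
  by move=> [].
apply; apply/andP; split; last first.
  by apply/forall_inP => A /setD1P[_ /imsetP[x _ ->]]; rewrite cards1.
apply/separatingP => D1 D2 d1 d2 nD.
have [x x0 nx] : exists2 x, x != ord0 & (x \in D1) != (x \in D2).
  apply/exists_inP; apply: contra_notT nD => /exists_inPn h.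
  have eqD : D1 :\ ord0 = D2 :\ ord0.
    apply/setP => x; rewrite !inE; case: eqVneq => //= /h.
    by rewrite negbK => /eqP.
  have e0 : (ord0 \in D1) = (ord0 \in D2).
    apply/eqP; move: d1; rewrite -d2 (cardsD1 ord0 D1) (cardsD1 ord0 D2) eqD.
    by do 2 case: (_ \in _) => //=; rewrite ?add0n ?add1n => /eqP;
       rewrite ?(gtn_eqF (ltnSn _)) ?(ltn_eqF (ltnSn _)).
  apply/setP => x; case: (eqVneq x ord0) => [-> // | /h].
  by rewrite negbK => /eqP.
exists [set x]; last exact: separates1.
by rewrite !inE (inj_eq set1_inj) x0 imset_f.
Qed.

(* Main.v *)
Require Import Defs.
From mathcomp Require Import all_boot all_order all_algebra.
From mathcomp Require Import zify ring.

(* Dually, let [S x] be the set of queries containing x, a subset of the set V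
   of all queries.  The family is d-separating iff the unions of the [S x] over
   the d-subsets are pairwise distinct, and every v : V lies in at most k of the
   sets [S x]; everything then follows from estimates of the sum of the [#|S x|],
   which is at most k * #|V|.

   Lower bound for d = 2.  At most one [S x] is empty.  Each x with [S x] a
   singleton is charged to some w such that [S w] contains [S x] and either
   [#|S w| > 2], or w is alone in some query (which then wastes k - 1 >= 1
   places); the charging is injective, so the average of [#|S x|] is at least 2
   up to the empty set.

   Lower bound for d = 3.  At most one [S x] is empty, at most #|V| are
   singletons, and those of size 2 form a forest, hence number at most #|V| - 1.

   Upper bound for d = 2.  The edges of a graph of girth at least 5 together with
   one empty set have the required property.  Such a graph with maximum degree k
   and any number j <= k * #|V| / 2 of edges exists as soon as #|V| is large: if
   u and v have degree less than k, an edge ab far from both may be replaced by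
   ua and vb, which creates no short cycle.

   Upper bound for d = 3.  Writing x = (i, j) with j < k, take the three
   partitions of the ground set into the level sets of i + K ^ t * a_j modulo
   M = ceil(n / k), t = 0, 1, 2, where a is a Sidon sequence and K is large.
   Reading congruences digit by digit in base K excludes all short cycles of the
   resulting 3-uniform hypergraph. *)

Set Implicit Arguments.
Unset Strict Implicit.
Unset Printing Implicit Defensive.

Import Order.TTheory GRing.Theory Num.Theory.

(** * Duality *)

Definition response (X V : finType) (S : X -> {set V}) (D : {set X}) : {set V} :=
  \bigcup_(x in D) S x.

Definition fiber (X V : finType) (S : X -> {set V}) (v : V) : {set X} :=
  [set x | v \in S x].

(** Dual form of an admissible family: the points of [V] index the queries, and several of them may
    have the same fiber. *)
Definition code (d k : nat) (X V : finType) (S : X -> {set V}) : Prop :=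
  (forall v, #|fiber S v| <= k) /\
  (forall D1 D2 : {set X}, #|D1| = d -> #|D2| = d ->
     response S D1 = response S D2 -> D1 = D2).

Lemma mem_response (X V : finType) (S : X -> {set V}) D v :
  (v \in response S D) = (fiber S v :&: D != set0).
Proof.
apply/bigcupP/set0Pn => [[x xD vS]|[x]]; first by exists x; rewrite !inE vS.
by rewrite !inE => /andP[vS xD]; exists x.
Qed.

Lemma response1 (X V : finType) (S : X -> {set V}) x : response S [set x] = S x.
Proof. exact: big_set1. Qed.

Lemma responseU (X V : finType) (S : X -> {set V}) D1 D2 :
  response S (D1 :|: D2) = response S D1 :|: response S D2.
Proof.
by apply/setP => v; rewrite inE !mem_response setIUr setU_eq0 negb_and.
Qed.

Lemma card_setU_leq (T : finType) (A B : {set T}) : #|A :|: B| <= #|A| + #|B|.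
Proof. by rewrite cardsU leq_subr. Qed.

Lemma card_bigcup_leq (I T : finType) (P : pred I) (F : I -> {set T}) :
  #|\bigcup_(i | P i) F i| <= \sum_(i | P i) #|F i|.
Proof.
elim/big_ind2: _ => [|A a B b Aa Bb|//]; first by rewrite cards0.
exact: leq_trans (card_setU_leq _ _) (leq_add Aa Bb).
Qed.

Lemma fresh (X : finType) (s : seq X) : size s < #|[set: X]| -> exists w, w \notin s.
Proof.
move=> sX; apply/existsP; apply: contraTT sX => /existsPn all_s.
rewrite -leqNgt (leq_trans _ (card_size s)) //; apply/subset_leq_card/subsetP => x _.
by have := all_s x; rewrite negbK.
Qed.

Lemma q_le_code n d k (V : finType) (S : 'I_n -> {set V}) :
  0 < k -> code d k S -> q n d k <= #|V|.
Proof.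
move=> k0 [fk inj]; have [_ qmin] := @qP n d k k0.
have aF : admissible d k [set fiber S v | v : V].
  apply/andP; split; last by apply/forall_inP => A /imsetP[v _ ->].
  apply/separatingP => D1 D2 d1 d2 nD.
  have [v] : exists v, (v \in response S D1) != (v \in response S D2).
    apply/existsP; apply: contra_notT nD; rewrite negb_exists => /forallP h.
    by apply: inj => //; apply/setP => v; apply/eqP; rewrite -[_ == _]negbK h.
  rewrite !mem_response => nv; exists (fiber S v); first exact: imset_f.
  by move: nv; rewrite /separates; do 2 case: (_ == set0).
by apply: leq_trans (qmin _ aF) _; apply: leq_trans (leq_imset_card _ _) _.
Qed.

Lemma q_code n d k : 0 < k -> exists S : 'I_n -> {set 'I_(q n d k)}, code d k S.
Proof.
move=> k0; have [[F /andP[/separatingP sF /forall_inP kF] <-] _] := @qP n d k k0.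
pose S (x : 'I_n) := [set i : 'I_#|F| | x \in enum_val i].
have fS i : fiber S i = enum_val i by apply/setP => x; rewrite !inE.
exists S; split=> [i|D1 D2 d1 d2 eqD]; first by rewrite fS kF // enum_valP.
apply/eqP/negPn/negP => /eqP nD; have [A AF] := sF _ _ d1 d2 nD.
have := congr1 (fun D : {set _} => enum_rank_in AF A \in D) eqD.
rewrite !mem_response !fS enum_rankK_in // /separates.
by do 2 case: (_ == set0).
Qed.

Lemma sum_card_fiber (X V : finType) (S : X -> {set V}) :
  \sum_v #|fiber S v| = \sum_x #|S x|.
Proof.
under eq_bigr => v _ do rewrite -sum1_card big_mkcond /=.
rewrite exchange_big; apply: eq_bigr => x _ /=.
by rewrite -sum1_card [RHS]big_mkcond; apply: eq_bigr => v _; rewrite inE.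
Qed.

(** Comparing only pairs with a common element [w] retains all the separation that the lower bound
    needs. *)
Lemma code2_cancel k (X V : finType) (S : X -> {set V}) : code 2 k S ->
  forall x y w, x != w -> y != w -> S x :|: S w = S y :|: S w -> x = y.
Proof.
move=> [_ inj] x y w xw yw e.
have /setP/(_ x) : [set x; w] = [set y; w].
  by apply: inj; rewrite ?cards2 ?xw ?yw // !responseU !response1.
by rewrite !inE eqxx (negPf xw) !orbF => /esym/eqP.
Qed.

Lemma code3_cancel k (X V : finType) (S : X -> {set V}) : code 3 k S ->
  forall x y u v, uniq [:: x; u; v] -> uniq [:: y; u; v] ->
  S x :|: (S u :|: S v) = S y :|: (S u :|: S v) -> x = y.
Proof.
move=> [_ inj] x y u v; rewrite /= !inE !negb_or !andbT.
move=> /andP[/andP[xu xv] uv] /andP[/andP[yu yv] _] e.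
have /setP/(_ x) : x |: [set u; v] = y |: [set u; v].
  apply: inj; last by rewrite !responseU !response1.
    by rewrite cardsU1 cards2 uv !inE negb_or xu xv.
  by rewrite cardsU1 cards2 uv !inE negb_or yu yv.
by rewrite !inE eqxx (negPf xu) (negPf xv) !orbF => /esym/eqP.
Qed.

(** * Lower bounds *)

Section LowerTwo.
Variables (k : nat) (X V : finType) (S : X -> {set V}).
Hypothesis k2 : 2 <= k.
Hypothesis X_ge3 : 3 <= #|[set: X]|.
Hypothesis fk : forall v, #|fiber S v| <= k.
Hypothesis cancelS : forall x y w, x != w -> y != w ->
  S x :|: S w = S y :|: S w -> x = y.

Lemma code2_inj : injective S.
Proof.
move=> x y exy; have [w /andP[xw yw]] : exists w, (x != w) && (y != w).
  have [w] : exists w, w \notin [:: x; y] by apply: fresh.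
  rewrite !inE negb_or => /andP[wx wy]; exists w.
  by rewrite [x == w]eq_sym [y == w]eq_sym wx.
by apply: (cancelS xw yw); rewrite exy.
Qed.

Lemma code2_sub x y w : x != w -> y != w ->
  S x \subset S w -> S y \subset S w -> x = y.
Proof.
by move=> xw yw /setUidPr sx /setUidPr sy; apply: (cancelS xw yw); rewrite sx.
Qed.

(** This makes the charging injective. When [x] or [y] is [w] itself, the inclusion between
    singletons is an equality and [code2_inj] applies. *)
Lemma code2_sub1 x y w : #|S x| = 1 -> #|S y| = 1 ->
  S x \subset S w -> S y \subset S w -> x = y.
Proof.
move=> x1 y1 sx sy; have [xw|xw] := eqVneq x w; have [yw|yw] := eqVneq y w.
- by rewrite xw yw.
- apply/esym/code2_inj/eqP; rewrite eqEcard x1 y1 leqnn.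
  by rewrite xw sy.
- apply/code2_inj/eqP; rewrite eqEcard x1 y1 leqnn.
  by rewrite yw sx.
- exact: code2_sub sx sy.
Qed.

Definition heavy : {set X} := [set w | 2 < #|S w|].
Definition lonely : {set V} := [set v | #|fiber S v| == 1].
Definition owner : {set X} := [set w | [exists v in lonely, v \in S w]].

Lemma card_owner : #|owner| <= #|lonely|.
Proof.
have sub : owner \subset \bigcup_(v in lonely) fiber S v.
  apply/subsetP => w; rewrite inE => /exists_inP[v vl vw].
  by apply/bigcupP; exists v => //; rewrite inE.
apply: leq_trans (subset_leq_card sub) _; apply: leq_trans (card_bigcup_leq _ _) _.
by rewrite -sum1_card; apply: leq_sum => v; rewrite inE => /eqP ->.
Qed.

(** If [x] is alone in its query [v], it is charged to itself. Otherwise some other [S y] contains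
    [v]; if [y] is not heavy, then [S y = [set v; b]], and [y] is alone in [b]: for any other [w] in
    [b] the pairs [x, w] and [y, w] would have the same response. *)
Lemma code2_charge x : #|S x| = 1 ->
  exists2 w, w \in heavy :|: owner & S x \subset S w.
Proof.
move=> x1; have /cards1P[v Sx] : #|S x| == 1 by rewrite x1.
have vx : v \in S x by rewrite Sx set11.
have [/existsP[y /andP[yx vy]]|/existsPn none] :=
  boolP [exists y, (y != x) && (v \in S y)]; last first.
  exists x => //; rewrite !inE; apply/orP; right; apply/exists_inP; exists v => //.
  rewrite inE; apply/cards1P; exists x; apply/setP => y; rewrite !inE.
  have [->|yx] := eqVneq y x; first exact: vx.
  by have := none y; rewrite yx => /negPf.
have sxy : S x \subset S y by rewrite Sx sub1set.
exists y => //; rewrite !inE; have [//|y2] := ltnP 2 #|S y|; rewrite /=.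
have := cardsD1 v (S y); rewrite vy add1n => cy.
have [/eqP y1|] := boolP (#|S y :\ v| == 0).
  have ex : S x = S y by apply/eqP; rewrite eqEcard sxy x1 cy y1.
  by move/code2_inj: ex yx => ->; rewrite eqxx.
move=> y1; have /cards1P[b Sb] : #|S y :\ v| == 1 by lia.
have [bv bY] : b != v /\ b \in S y by apply/andP; rewrite -in_setD1 Sb set11.
apply/exists_inP; exists b => //; rewrite inE; apply/cards1P; exists y.
apply/setP => w; rewrite !inE; have [->|wy] := eqVneq w y; first exact: bY.
apply/negP => bw; have xw : x != w.
  by apply: contraNneq bv => xw; move: bw; rewrite -xw Sx inE.
have : x = y; last by move=> exy; move: yx; rewrite exy eqxx.
apply: (cancelS xw); first by rewrite eq_sym.
have -> : S y = v |: [set b] by rewrite -Sb setD1K.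
rewrite Sx -setUA; congr (_ :|: _); apply/esym/setUidPr.
by rewrite sub1set.
Qed.

Lemma code2_bound : 2 * #|[set: X]|.-1 <= #|[set: V]| * k.
Proof.
pose l := [set x | #|S x| == 1]; pose z := [set x | #|S x| == 0].
have z1 : #|z| <= 1.
  apply/card_le1_eqP => x y; rewrite !inE !cards_eq0 => /eqP x0 /eqP y0.
  by apply: code2_inj; rewrite x0.
have l1 : #|l| <= #|heavy| + #|lonely|.
  have [f fP] : exists f : X -> X, forall x, x \in l ->
      f x \in heavy :|: owner /\ S x \subset S (f x).
    (* On [l] the default [x] is never reached, by [code2_charge]. *)
    exists (fun x => odflt x [pick w in heavy :|: owner | S x \subset S w]) => x.
    rewrite inE => /eqP/code2_charge[w wW sw].
    by case: pickP => [u /andP[]//|/(_ w)]; rewrite wW sw.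
  rewrite -(@card_in_imset _ _ f); last first.
    move=> x y xl yl fxy; have [_ sx] := fP x xl; have [_ sy] := fP y yl.
    move: xl yl; rewrite !inE => /eqP x1 /eqP y1.
    by apply: (code2_sub1 x1 y1 sx); rewrite fxy.
  apply: leq_trans (_ : #|heavy :|: owner| <= _).
    by apply/subset_leq_card/subsetP => _ /imsetP[x /fP[+ _] ->].
  apply: leq_trans (card_setU_leq _ _) _.
  by rewrite leq_add2l card_owner.
have capV : \sum_v #|fiber S v| + #|lonely| <= #|[set: V]| * k.
  rewrite -sum1_card [X in _ + X]big_mkcond -big_split /=.
  have -> : #|[set: V]| * k = \sum_(v : V) k by rewrite sum_nat_const cardsT.
  by apply: leq_sum => v _; rewrite inE; have := fk v; case: eqP; lia.
(* This holds term by term. The bonus for heavy sets, together with the places wasted by lonely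
   queries, pays for the singletons through [l1]. *)
have degX : 2 * #|[set: X]| + #|heavy| <= \sum_x #|S x| + #|l| + 2 * #|z|.
  have -> : 2 * #|[set: X]| = \sum_(x : X) 2.
    by rewrite sum_nat_const cardsT mulnC.
  rewrite -!sum1_card !big_distrr /= [X in _ + X <= _]big_mkcond.
  rewrite [X in _ + X + _]big_mkcond [X in _ <= _ + X]big_mkcond -!big_split /=.
  by apply: leq_sum => x _; rewrite !inE; case: #|S x| => [|[|[|]]] //=; lia.
by move: capV; rewrite sum_card_fiber; lia.
Qed.

End LowerTwo.

(** * Lower bound for [d = 3]: the sets of size 2 form a forest *)

Section LowerThree.
Variables (k : nat) (X V : finType) (S : X -> {set V}).
Hypothesis X_ge5 : 5 <= #|[set: X]|.
Hypothesis fk : forall v, #|fiber S v| <= k.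
Hypothesis cancelS : forall x y u v, uniq [:: x; u; v] -> uniq [:: y; u; v] ->
  S x :|: (S u :|: S v) = S y :|: (S u :|: S v) -> x = y.

Lemma code3_inj : injective S.
Proof.
move=> x y exy.
have [u] : exists u, u \notin [:: x; y] by apply: fresh; apply: leq_trans X_ge5.
have [v] : exists v, v \notin [:: x; y; u] by apply: fresh; apply: leq_trans X_ge5.
rewrite !inE !negb_or => /and3P[vx vy vu] /andP[ux uy].
apply: (@cancelS x y u v); last by rewrite exy.
  by rewrite /= !inE negb_or ![x == _]eq_sym ux vx eq_sym vu.
by rewrite /= !inE negb_or ![y == _]eq_sym uy vy eq_sym vu.
Qed.

(** The sets of size 2 are read as edges on [V]; these are the edges of the subgraph induced on
    [T]. *)
Definition inner (T : {set V}) := [set x | (#|S x| == 2) && (S x \subset T)].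

Lemma card2_pair x a : #|S x| == 2 -> a \in S x ->
  exists2 b, b != a & S x = [set a; b].
Proof.
move=> x2 ax; have := cardsD1 a (S x); rewrite ax (eqP x2) => -[].
move/esym/eqP/cards1P => [b Sb].
have : b \in S x :\ a by rewrite Sb set11.
by rewrite !inE => /andP[ba _]; exists b => //; rewrite -(setD1K ax) Sb.
Qed.

(* In a trail with edges ab, bc, cd, de the triples {ab, bc, de} and
   {ab, cd, de} have the same union; in a triangle any two edges do. *)
Lemma no_min_degree2 (T : {set V}) : T != set0 ->
  ~ forall v, v \in T -> 1 < #|[set x in inner T | v \in S x]|.
Proof.
case/set0Pn => a0 a0T dense.
(* With two edges at every vertex, a trail can always leave [v] by an edge other than the edge [x]
   by which it arrived. *)
have next x v : v \in T -> exists y w,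
    [/\ y != x, w != v, w \in T, #|S y| == 2 & S y = [set v; w]].
  move=> vT; have : 0 < #|[set x in inner T | v \in S x] :\ x|.
    have := dense v vT; rewrite (cardsD1 x [set x in inner T | v \in S x]).
    by case: (x \in _); lia.
  case/card_gt0P => y; rewrite !inE => /and3P[yx /andP[y2 /subsetP yT] vy].
  have [w wv Sy] := card2_pair y2 vy; exists y, w; split=> //.
  by apply: yT; rewrite Sy !inE eqxx orbT.
have [x0 _] : exists x : X, x \notin [::] by apply: fresh; apply: leq_trans X_ge5.
have [x1 [b [_ ba bT s1 S1]]] := next x0 a0 a0T.
have [x2 [c [n21 cb cT s2 S2]]] := next x1 b bT.
have [x3 [d [n32 dc dT s3 S3]]] := next x2 c cT.
have [x4 [e [n43 ed eT s4 S4]]] := next x3 d dT.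
have neS x y v : v \in S x -> v \notin S y -> x != y.
  by move=> vx; apply: contraNneq => <-.
have ca : c != a0.
  apply: contraNneq n21 => ca; apply/eqP/code3_inj.
  by rewrite S1 S2 ca setUC.
have db : d != b.
  apply: contraNneq n32 => db; apply/eqP/code3_inj.
  by rewrite S2 S3 db setUC.
have n31 : x3 != x1.
  by apply: (neS _ _ c); rewrite ?S1 ?S3 !inE ?eqxx // negb_or ca cb.
(* If [d = a0] the trail has closed into a triangle, and an arbitrary [u] fills up the triples. *)
have [da|da] := eqVneq d a0.
  have [u] : exists u, u \notin [:: x1; x2; x3] by apply: fresh; apply: leq_trans X_ge5.
  rewrite !inE !negb_or => /and3P[u1 u2 u3].
  have : x1 = x3; last by move=> e13; rewrite e13 eqxx in n31.
  apply: (@cancelS x1 x3 x2 u).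
  - by rewrite /= !inE negb_or ![_ == u]eq_sym u1 u2 eq_sym n21.
  - by rewrite /= !inE negb_or ![_ == u]eq_sym u3 u2 n32.
  apply/setP => v; rewrite S1 S2 S3 da !inE.
  by case: (v == a0); case: (v == b); case: (v == c); rewrite ?orbT.
(* The end [e] may coincide with [a0] or [b]; only the distinctness of the edges matters. *)
have n41 : x4 != x1.
  by apply: (neS _ _ d); rewrite ?S1 ?S4 !inE ?eqxx // negb_or da db.
have n42 : x4 != x2.
  by apply: (neS _ _ d); rewrite ?S2 ?S4 !inE ?eqxx // negb_or db dc.
have : x3 = x2; last by move=> e32; rewrite e32 eqxx in n32.
apply: (@cancelS x3 x2 x1 x4).
- by rewrite /= !inE negb_or n31 ![_ == x4]eq_sym n43 n41.
- by rewrite /= !inE negb_or n21 ![_ == x4]eq_sym n42 n41.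
apply/setP => v; rewrite S1 S2 S3 S4 !inE.
by case: (v == a0); case: (v == b); case: (v == c); case: (v == d); rewrite ?orbT.
Qed.

(* Removing leaves one by one shows that the size-2 sets form a forest. *)
Lemma card_inner (T : {set V}) : T != set0 -> #|inner T| < #|T|.
Proof.
elim: {T}#|T| {-2}T (erefl #|T|) => [|t IH] T cT T0.
  by move: T0; rewrite -cards_eq0 cT.
have [v vT small] : exists2 v, v \in T & #|[set x in inner T | v \in S x]| <= 1.
  apply/exists_inP; apply: contraT => /exists_inPn dense.
  by case: (no_min_degree2 T0) => v /dense; rewrite -ltnNge.
have := cardsD1 v T; rewrite vT cT add1n => -[ct].
have [/eqP Tv|Tv] := boolP (T :\ v == set0).
  rewrite (_ : inner T = set0) ?cards0 //; apply/setP => x; rewrite !inE.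
  apply/negP => /andP[/eqP x2 /subset_leq_card].
  by rewrite x2 cT ct Tv cards0.
have := IH _ (esym ct) Tv; rewrite -ct => lt.
have : #|inner T| <= #|inner (T :\ v) :|: [set x in inner T | v \in S x]|.
  apply/subset_leq_card/subsetP => x; rewrite !inE subsetD1.
  by move=> /andP[-> ->]; case: (v \in S x).
move=> /leq_trans/(_ (card_setU_leq _ _)); lia.
Qed.

Lemma code3_bound : 3 * #|[set: X]| - 2 <= #|[set: V]| * (k + 3).
Proof.
have z1 : #|[set x | #|S x| == 0]| <= 1.
  apply/card_le1_eqP => x y; rewrite !inE !cards_eq0 => /eqP x0 /eqP y0.
  by apply: code3_inj; rewrite x0.
have l1 : #|[set x | #|S x| == 1]| <= #|[set: V]|.
  rewrite -(card_imset _ code3_inj).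
  rewrite -(card_imset [set: V] (@set1_inj V)); apply/subset_leq_card/subsetP.
  by move=> _ /imsetP[x + ->]; rewrite inE => /cards1P[v ->]; rewrite imset_f.
(* Without queries all the sets would be empty, but at most one is. *)
have V0 : 0 < #|[set: V]|.
  rewrite lt0n; apply/negP => /eqP V0; move: X_ge5.
  rewrite (_ : [set: X] = [set x | #|S x| == 0]) ?(leqNgt 5) ?(leq_ltn_trans z1) //.
  by apply/setP => x; rewrite !inE -leqn0 -V0 subset_leq_card ?subsetT.
have e2 : #|[set x | #|S x| == 2]| < #|[set: V]|.
  have -> : [set x | #|S x| == 2] = inner setT.
    by apply/setP => x; rewrite !inE subsetT andbT.
  by rewrite card_inner // -card_gt0.
have capV : \sum_v #|fiber S v| <= #|[set: V]| * k.
  have -> : #|[set: V]| * k = \sum_(v : V) k by rewrite sum_nat_const cardsT.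
  by apply: leq_sum => v _; apply: fk.
(* The weights 3, 2, 1 make up for sizes below 3; by the counts above they add at most [3 *
   #|[set: V]| + 2]. *)
have : 3 * #|[set: X]| <= \sum_x #|S x| + 3 * #|[set x | #|S x| == 0]|
          + 2 * #|[set x | #|S x| == 1]| + #|[set x | #|S x| == 2]|.
  have -> : 3 * #|[set: X]| = \sum_(x : X) 3.
    by rewrite sum_nat_const cardsT mulnC.
  rewrite -!sum1_card !big_distrr /= [X in _ + X + _ + _]big_mkcond.
  rewrite [X in _ + X + _]big_mkcond [X in _ <= _ + X]big_mkcond -!big_split /=.
  by apply: leq_sum => x _; rewrite !inE; case: #|S x| => [|[|[|]]] //=; lia.
by move: capV; rewrite sum_card_fiber; nia.
Qed.

End LowerThree.

(** * Tripartite hypergraphs on a grid *)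

(** Reduction modulo [L] and division by [L] recover the sum and the sum of squares of the two
    indices, and these determine the pair. *)
Lemma sidon L i1 i2 i3 i4 : i1 + i3 < L -> i2 + i4 < L ->
  i1 + L * i1 ^ 2 + (i3 + L * i3 ^ 2) = i2 + L * i2 ^ 2 + (i4 + L * i4 ^ 2) ->
  i1 = i2 \/ i1 = i4.
Proof.
move=> l13 l24 e.
have e1 : (i1 ^ 2 + i3 ^ 2) * L + (i1 + i3) = (i2 ^ 2 + i4 ^ 2) * L + (i2 + i4).
  by move: e; rewrite !mulnDl ![L * _]mulnC; lia.
have eS : i1 + i3 = i2 + i4.
  by have := congr1 (modn^~ L) e1; rewrite !modnMDl !modn_small.
have eQ : i1 ^ 2 + i3 ^ 2 = i2 ^ 2 + i4 ^ 2.
  have := congr1 (divn^~ L) e1; rewrite !divnMDl ?(leq_ltn_trans _ l13) //.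
  by rewrite !divn_small // !addn0.
have : ((i1%:Z - i2%:Z) * (i1%:Z - i4%:Z) = 0)%R by move: eS eQ; rewrite -!mulnn; nia.
by move/eqP; rewrite mulf_eq0 !subr_eq0 => /orP[]/eqP[]; [left|right].
Qed.

(** Uniqueness of the expansion in base [K]; [s, t, r] is any of the six orderings of the exponents
    0, 1, 2. *)
Lemma first_digit K (s t r : 'I_3) p p' p'' q' q q'' : uniq [:: s; t; r] ->
  p < K -> p' < K -> p'' < K -> q < K -> q' < K -> q'' < K ->
  K ^ s * p + K ^ t * p' + K ^ r * p'' = K ^ s * q + K ^ t * q' + K ^ r * q'' ->
  p = q.
Proof.
have base (u0 u1 u2 w0 w1 w2 : nat) : u0 < K -> u1 < K -> u2 < K ->
    w0 < K -> w1 < K -> w2 < K ->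
    (u2 * K + u1) * K + u0 = (w2 * K + w1) * K + w0 ->
    [/\ u0 = w0, u1 = w1 & u2 = w2].
  move=> U0 U1 U2 W0 W1 W2.
  have K0 : 0 < K by lia.
  have split u w u' w' : u' < K -> w' < K -> u * K + u' = w * K + w' ->
      u = w /\ u' = w'.
    move=> u'K w'K e; have := congr1 (divn^~ K) e; have := congr1 (modn^~ K) e.
    by rewrite !modnMDl !divnMDl // !modn_small // !divn_small // !addn0.
  by move=> /split[] // /split[] // -> ->.
case: s t r => [[|[|[|]]] // ?] [[|[|[|]]] // ?] [[|[|[|]]] // ?] //= _
  P P' P'' Q Q' Q''; rewrite ?expn0 ?expn1 -?mulnn => e.
- by case: (base p p' p'' q q' q'') => //; lia.
- by case: (base p p'' p' q q'' q') => //; lia.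
- by case: (base p' p p'' q' q q'') => //; lia.
- by case: (base p'' p p' q'' q q') => //; lia.
- by case: (base p' p'' p q' q'' q) => //; lia.
- by case: (base p'' p' p q'' q' q) => //; lia.
Qed.

Lemma digits_lt K (s t r : 'I_3) p p' p'' : uniq [:: s; t; r] ->
  p < K -> p' < K -> p'' < K -> K ^ s * p + K ^ t * p' + K ^ r * p'' < K ^ 3.
Proof.
move=> str P P' P''; have -> : K ^ 3 = K * K * K by rewrite expnS -mulnn mulnA.
have horner u v w : u < K -> v < K -> w < K -> (w * K + v) * K + u < K * K * K.
  move=> U W W'; have : w * K + v < K * K by nia.
  by nia.
have := horner _ _ _ P P' P''; have := horner _ _ _ P P'' P'.
have := horner _ _ _ P' P P''; have := horner _ _ _ P' P'' P.
have := horner _ _ _ P'' P P'; have := horner _ _ _ P'' P' P.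
case: s t r str => [[|[|[|]]] // ?] [[|[|[|]]] // ?] [[|[|[|]]] // ?] //= _.
all: by rewrite ?expn0 ?expn1 -?mulnn; lia.
Qed.

(** * Triples of edges in tripartite hypergraphs without short cycles *)

Section Tripartite.
Variables (X : finType) (Z : eqType) (f : 'I_3 -> X -> Z).
Hypothesis linear : forall s t x y,
  x != y -> f s x = f s y -> f t x = f t y -> s = t.
Hypothesis no_triangle : forall s t r x y z, uniq [:: s; t; r] ->
  x != y -> y != z -> z != x ->
  f s x = f s y -> f t y = f t z -> f r z = f r x -> False.
Hypothesis no_quadrangle : forall s t r x y z w, s != t -> r != t ->
  x != y -> y != z -> z != w -> w != x ->
  f s x = f s y -> f t y = f t z -> f r z = f r w -> f t w = f t x -> False.

Lemma mem_neq (D : {set X}) x y : x \notin D -> y \in D -> x != y.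
Proof. by move=> xD yD; apply: contraNneq xD => ->. Qed.

(** By linearity an edge of [D] meets [x] in at most one class, so the edges covering the three
    vertices of [x] are distinct and exhaust [D]. *)
Lemma matching (D : {set X}) x : #|D| = 3 -> x \notin D ->
  (forall t, exists2 y, y \in D & f t x = f t y) ->
  exists y : 'I_3 -> X, [/\ injective y, forall t, y t \in D,
    forall t, f t x = f t (y t) & forall z, z \in D -> exists t, y t = z].
Proof.
move=> D3 xD h.
have [y yD fy] := fin_all_exists2 h.
have y_inj : injective y.
  move=> s t est; have fs := fy s; rewrite est in fs.
  exact: (linear (mem_neq xD (yD t)) fs (fy t)).
exists y; split=> // z zD.
have : [set y t | t : 'I_3] == D.
  rewrite eqEcard card_imset // card_ord D3 leqnn andbT.
  by apply/subsetP => _ /imsetP[t _ ->].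
by move/eqP/setP/(_ z); rewrite zD => /imsetP[t _ ->]; exists t.
Qed.

(** If the triples differ, the absence of triangles forces them to be disjoint. Two edges of [D1]
    are then matched to [D2] in different ways, which yields a quadrangle. *)
Lemma triple_determined (D1 D2 : {set X}) : #|D1| = 3 -> #|D2| = 3 ->
  (forall t x, x \in D1 -> exists2 y, y \in D2 & f t x = f t y) ->
  (forall t x, x \in D2 -> exists2 y, y \in D1 & f t x = f t y) -> D1 = D2.
Proof.
move=> d1 d2 h12 h21; apply/eqP; rewrite eqEcard d1 d2 leqnn andbT.
apply/negPn/negP => n12.
have /subsetPn[w w2 w1] : ~~ (D2 \subset D1).
  apply: contra n12 => s21.
  by have /eqP -> : D2 == D1; rewrite ?subxx // eqEcard s21 d1 d2.
have [x x1 x2] := subsetPn n12.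
have [y [y_inj yD fy y_surj]] := matching d2 x2 (fun t => h12 t x x1).
have [z [z_inj zD fz z_surj]] := matching d1 w1 (fun t => h21 t w w2).
(* Each of [x] and [w] meets the other, by linearity in the same class [c = r]. *)
have [r yr] := y_surj w w2; have [c zc] := z_surj x x1.
have fr : f r x = f r w by rewrite -yr.
have ecr : c = r.
  by apply: (linear (mem_neq w1 x1) _ (esym fr)); rewrite fz zc.
(* A common edge [y s] would meet both [x] and [w], closing a triangle. *)
have disj s : y s \notin D1.
  apply/negP => ys1; have [esr|nsr] := eqVneq s r.
    by move: w1; rewrite -yr -esr ys1.
  have [t zt] := z_surj _ ys1.
  have ntr : t != r.
    by apply: contraTneq x1 => tr; have := yD s; rewrite -zt tr -ecr zc (negPf x2).
  have nts : t != s.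
    apply: contra_neqN nsr => /eqP ts; apply: (linear (mem_neq w1 x1)).
      by rewrite fy -zt -ts fz.
    exact: esym.
  apply: (@no_triangle s t r x (y s) w); rewrite ?fy //.
  - by rewrite /= !inE negb_or [s == t]eq_sym nts nsr ntr.
  - exact: mem_neq x2 (yD s).
  - by rewrite eq_sym; apply: mem_neq w1 ys1.
  - exact: mem_neq w1 x1.
  - by rewrite fz zt.
  - by rewrite yr.
have [x' /andP[x'x x'1]] : exists x', (x' != x) && (x' \in D1).
  have := cardsD1 x D1; rewrite x1 d1 add1n => -[e].
  have /card_gt0P[x'] : 0 < #|D1 :\ x| by rewrite -e.
  by rewrite !inE => ?; exists x'.
have x'2 : x' \notin D2.
  by apply/negP => /y_surj[s ys]; move: (disj s); rewrite ys x'1.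
have [y' [y'_inj y'D fy' y'_surj]] := matching d2 x'2 (fun t => h12 t x' x'1).
(* Agreement of the two matchings at two indices would already give [x] and [x'] two common
   vertices. *)
have [s nfix] : exists s, y' s != y s.
  have [e0|] := eqVneq (y' ord0) (y ord0); last by exists ord0.
  have [e1|] := eqVneq (y' ord_max) (y ord_max); last by exists ord_max.
  have : ord0 = ord_max :> 'I_3; last by [].
  by rewrite eq_sym in x'x; apply: (linear x'x); rewrite fy fy' ?e0 ?e1.
(* The edges [y s] and [y t] meet [x] in classes [s], [t] and [x'] in classes [t], [p], so class [t]
   occurs at opposite corners. *)
have [t yt] := y'_surj _ (yD s); have [p yp] := y'_surj _ (yD t).
have nst : s != t by apply: contra_neq nfix => e; rewrite [in LHS]e yt.
have npt : p != t.
  by apply: contra_neq nst => pt; apply: y_inj; rewrite -yt -yp pt.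
apply: (@no_quadrangle s t p x (y s) x' (y t)) => //.
- exact: mem_neq x2 (yD s).
- by rewrite eq_sym; apply: mem_neq x'2 (yD s).
- exact: mem_neq x'2 (yD t).
- by rewrite eq_sym; apply: mem_neq x2 (yD t).
- by rewrite -yt fy'.
- by rewrite fy' yp.
Qed.

End Tripartite.

(** * The grid and its three families of lines modulo [M] *)

Section Grid.
Variables (k M : nat) (X : finType) (I J : X -> nat).
(** [L] exceeds any sum of two values of [J], as [sidon] requires; [K] exceeds any sum of two values
    [a (J x)], so that such a sum is a single digit. *)
Let L := 2 * k.
Let a j := j + L * j ^ 2.
Let K := 2 * a k + 1.
Hypothesis k_gt0 : 0 < k.
Hypothesis M_large : K ^ 3 <= M.
Hypothesis I_lt : forall x, I x < M.
Hypothesis J_lt : forall x, J x < k.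
Hypothesis IJ_inj : forall x y, I x = I y -> J x = J y -> x = y.

Definition line (t : 'I_3) (x : X) : 'Z_M := ((I x)%:R + (K ^ t * a (J x))%:R)%R.

Let a_lt x : a (J x) <= a k.
Proof.
have := J_lt x => /ltnW le_jk; apply: leq_add => //.
by rewrite leq_mul2l leq_exp2r // le_jk orbT.
Qed.

Let a_ltK x : a (J x) < K.
Proof. by have := a_lt x; rewrite /K; lia. Qed.

Let K_gt1 : 1 < K.
Proof. by rewrite /K /a; nia. Qed.

Let M_gt1 : 1 < M.
Proof. by apply: leq_trans M_large; rewrite (leq_trans K_gt1) // -{1}(expn1 K) leq_exp2l. Qed.

Lemma natZ_inj m n : m < M -> n < M -> (m%:R = n%:R :> 'Z_M)%R -> m = n.
Proof.
by move=> mM nM /(congr1 val) /=; rewrite !val_Zp_nat // !modn_small.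
Qed.

(** Both numbers are below [K ^ 3 <= M], so the congruence is an equality. *)
Lemma first_digit_mod (s t r : 'I_3) p p' p'' q q' q'' : uniq [:: s; t; r] ->
  p < K -> p' < K -> p'' < K -> q < K -> q' < K -> q'' < K ->
  ((K ^ s * p + K ^ t * p' + K ^ r * p'')%:R =
    (K ^ s * q + K ^ t * q' + K ^ r * q'')%:R :> 'Z_M)%R -> p = q.
Proof.
have lt_M u u' u'' : uniq [:: s; t; r] -> u < K -> u' < K -> u'' < K ->
    K ^ s * u + K ^ t * u' + K ^ r * u'' < M.
  by move=> str uK u'K u''K; apply: leq_trans M_large; apply: digits_lt.
move=> str P P' P'' Q Q' Q'' /natZ_inj e.
by apply: (first_digit str P P' P'' Q Q' Q''); apply: e; apply: lt_M.
Qed.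

Lemma line_inj t x y : line t x = line t y -> J x = J y -> x = y.
Proof.
move=> e exy; apply: (IJ_inj _ exy); apply: natZ_inj => //.
by move: e; rewrite /line exy => /addIr.
Qed.

Lemma a_inj x y : a (J x) = a (J y) -> J x = J y.
Proof.
have a_mono i j : i < j -> a i < a j.
  move=> ij; apply: (@leq_add i.+1) => //.
  by rewrite leq_mul2l leq_exp2r // ltnW ?orbT.
by case: (ltngtP (J x) (J y)) => // /a_mono + e; rewrite e ltnn.
Qed.

Lemma third_index (s t : 'I_3) : s != t -> exists r, uniq [:: s; t; r].
Proof.
move=> st; have [r] : exists r : 'I_3, r \notin [:: s; t].
  by apply: fresh; rewrite cardsT card_ord.
rewrite !inE negb_or => /andP[rs rt]; exists r.
by rewrite /= !inE negb_or st !(eq_sym _ r) rs rt.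
Qed.

(* In the three lemmas below, the sum of the equations cancels the terms [I _];
   comparing one digit in base K gives an equation between values of [a]. *)
Lemma line_linear s t x y :
  x != y -> line s x = line s y -> line t x = line t y -> s = t.
Proof.
move=> xy es et; apply/eqP; apply: contraNT xy => st; apply/eqP.
apply: (line_inj es); apply: a_inj.
have [r str] := third_index st.
apply: (@first_digit_mod s t r _ (a (J y)) 0 _ (a (J x)) 0 str);
  rewrite ?a_ltK ?(ltnW K_gt1) //.
apply: (addrI ((I x)%:R + (I y)%:R)%R); rewrite !natrD !muln0.
transitivity (line s x + line t y)%R; first by rewrite /line; ring.
by rewrite es -et /line; ring.
Qed.

Lemma line_triangle s t r x y z : uniq [:: s; t; r] ->
  x != y -> y != z -> z != x ->
  line s x = line s y -> line t y = line t z -> line r z = line r x -> False.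
Proof.
move=> str /eqP xy _ _ es et er; apply/xy/(line_inj es)/a_inj.
apply: (@first_digit_mod s t r _ (a (J y)) (a (J z)) _ (a (J z)) (a (J x)) str);
  rewrite ?a_ltK //.
apply: (addrI ((I x)%:R + (I y)%:R + (I z)%:R)%R); rewrite !natrD.
transitivity (line s x + line t y + line r z)%R; first by rewrite /line; ring.
by rewrite es et er /line; ring.
Qed.

Lemma line_quadrangle s t r x y z w : s != t -> r != t ->
  x != y -> y != z -> z != w -> w != x ->
  line s x = line s y -> line t y = line t z ->
  line r z = line r w -> line t w = line t x -> False.
Proof.
move=> st rt /eqP xy /eqP yz _ _ es et er et'.
(* This is the comparison of the digits at [K ^ t], the exponent that occurs twice in the cycle. *)
suff /sidon [||e|e] : a (J y) + a (J w) = a (J z) + a (J x).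
- by rewrite /L; have := J_lt y; have := J_lt w; lia.
- by rewrite /L; have := J_lt z; have := J_lt x; lia.
- exact/yz/(line_inj et).
- exact/xy/esym/(line_inj (esym es)).
have aD u v : a (J u) + a (J v) < K.
  by rewrite /K; have := a_lt u; have := a_lt v; lia.
have cycle : (line s x + line t y + line r z + line t w =
    line s y + line t z + line r w + line t x)%R by rewrite es et er et'.
rewrite eq_sym in st; rewrite eq_sym in rt.
(* For [s = r] the other two terms merge into one digit; otherwise they occupy two digits. *)
have [esr|nsr] := eqVneq s r.
  have [u tsu] := third_index st.
  apply: (@first_digit_mod t s u _ (a (J x) + a (J z)) 0 _ (a (J y) + a (J w)) 0 tsu);
    rewrite ?aD ?(ltnW K_gt1) //.
  apply: (addrI ((I x)%:R + (I y)%:R + (I z)%:R + (I w)%:R)%R).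
  rewrite !(mulnDr _ (a _)) !natrD !muln0.
  transitivity (line s x + line t y + line r z + line t w)%R.
    by rewrite -esr /line; ring.
  by rewrite cycle -esr /line; ring.
apply: (@first_digit_mod t s r _ (a (J x)) (a (J z)) _ (a (J y)) (a (J w)));
  rewrite ?aD ?a_ltK //; first by rewrite /= !inE negb_or st rt nsr.
apply: (addrI ((I x)%:R + (I y)%:R + (I z)%:R + (I w)%:R)%R).
rewrite !(mulnDr _ (a _)) !natrD.
transitivity (line s x + line t y + line r z + line t w)%R; first by rewrite /line; ring.
by rewrite cycle /line; ring.
Qed.

(** On a line [J] is injective with fewer than [k] as its values, hence the fiber bound; separation
    is [triple_determined]. *)
Lemma grid_code :
  code 3 k (fun x => [set tz | line tz.1 x == tz.2] : {set 'I_3 * 'Z_M}).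
Proof.
split=> [[t z]|D1 D2 d1 d2 /setP e].
  have Jinj : {in fiber (fun x => [set tz | line tz.1 x == tz.2]) (t, z) &,
      injective (fun x => Ordinal (J_lt x))}.
    move=> x y; rewrite !inE /= => /eqP ex /eqP ey [exy].
    by apply: (@line_inj t) exy; rewrite ex ey.
  by rewrite -(card_in_imset Jinj) -[X in _ <= X]card_ord max_card.
have sub D D' : response (fun x => [set tz | line tz.1 x == tz.2]) D =i
    response (fun x => [set tz | line tz.1 x == tz.2]) D' ->
    forall t x, x \in D -> exists2 y, y \in D' & line t x = line t y.
  move=> {}e t x xD; have /bigcupP[y yD] : (t, line t x) \in
      response (fun x => [set tz | line tz.1 x == tz.2]) D'.
    by rewrite -e; apply/bigcupP; exists x; rewrite ?inE.
  by rewrite inE /= => /eqP ey; exists y.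
apply: (triple_determined line_linear line_triangle line_quadrangle d1 d2).
  exact: sub.
by apply: sub => v; rewrite e.
Qed.

End Grid.

(** * Graphs of girth at least 5 *)

Section Graph.
Variables (V : finType) (k : nat).
Implicit Types E : {set {set V}}.

Definition adj E (x y : V) : bool := (x != y) && ([set x; y] \in E).

(** The degree bound [k] is included. In a 4-cycle only opposite vertices need to be required
    distinct, since [adj] separates consecutive ones. *)
Definition girth5 E : Prop := [/\ forall e, e \in E -> #|e| = 2,
  forall v, #|[set e in E | v \in e]| <= k,
  forall a b c, adj E a b -> adj E b c -> adj E c a -> False &
  forall a b c d, a != c -> b != d ->
    adj E a b -> adj E b c -> adj E c d -> adj E d a -> False].

Lemma adj_sym E x y : adj E x y = adj E y x.
Proof. by rewrite /adj eq_sym setUC. Qed.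

Lemma sum_degree E : (forall e, e \in E -> #|e| = 2) ->
  \sum_v #|[set e in E | v \in e]| = 2 * #|E|.
Proof.
move=> E2; rewrite mulnC -sum_nat_const.
under eq_bigr => v _ do rewrite -sum1_card.
rewrite (exchange_big_dep (mem E)) /=; last by move=> v e _; rewrite inE => /andP[].
apply: eq_bigr => e eE; rewrite -(E2 e eE) -sum1_card.
by apply: eq_bigl => v; rewrite inE eE.
Qed.

Lemma degreeU1 E f w :
  #|[set e in f |: E | w \in e]| <= (w \in f) + #|[set e in E | w \in e]|.
Proof.
have sub : [set e in f |: E | w \in e] \subset
    [set e in [set f] | w \in f] :|: [set e in E | w \in e].
  apply/subsetP => e; rewrite !inE => /andP[/orP[/eqP->|->] we]; rewrite we ?eqxx //.
  by rewrite orbT.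
apply: leq_trans (subset_leq_card sub) _; apply: leq_trans (card_setU_leq _ _) _.
rewrite leq_add2r; case: (w \in f).
  by apply: leq_trans (subset_leq_card (_ : _ \subset [set f])) _;
    rewrite ?cards1 //; apply/subsetP => e; rewrite !inE andbT.
by rewrite leqn0 cards_eq0; apply/eqP/setP => e; rewrite !inE andbF.
Qed.

Lemma deficient (g : V -> nat) : (forall v, g v <= k) -> \sum_v g v < k * #|V| ->
  exists2 u, g u < k & forall v, g v + (v == u) <= k.
Proof.
move=> gk lt; have [u gu] : exists u, g u < k.
  apply/existsP; apply: contraTT lt => /existsPn all_k.
  rewrite -leqNgt mulnC -sum_nat_const; apply: leq_sum => v _.
  by have := all_k v; rewrite -leqNgt.
exists u => // v; case: eqP => [->|_]; first by rewrite addn1.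
by rewrite addn0.
Qed.

(** * Neighbourhoods and edge switching *)

Definition incident E (X : {set V}) := [set e in E | ~~ [disjoint e & X]].
Definition ball E (X : {set V}) := X :|: cover (incident E X).

Lemma card_incident E (X : {set V}) : girth5 E -> #|incident E X| <= k * #|X|.
Proof.
case=> _ Ek _ _; rewrite mulnC -sum_nat_const.
have sub : incident E X \subset \bigcup_(x in X) [set e in E | x \in e].
  apply/subsetP => e; rewrite inE => /andP[eE /pred0Pn[x /andP[xe xX]]].
  by apply/bigcupP; exists x => //; rewrite inE eE.
apply: leq_trans (subset_leq_card sub) _; apply: leq_trans (card_bigcup_leq _ _) _.
by apply: leq_sum => x _; apply: Ek.
Qed.

Lemma card_ball E (X : {set V}) : girth5 E -> #|ball E X| <= (2 * k).+1 * #|X|.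
Proof.
move=> gE; apply: leq_trans (card_setU_leq _ _) _.
rewrite mulSn leq_add2l -mulnA; have [E2 _ _ _] := gE.
apply: leq_trans (card_bigcup_leq _ _) _.
apply: leq_trans (_ : 2 * #|incident E X| <= _); last first.
  by rewrite leq_mul2l card_incident.
rewrite mulnC -sum_nat_const; apply: leq_sum => e.
by rewrite inE => /andP[/E2 -> _].
Qed.

Lemma ball_sub E (X : {set V}) x : x \in X -> x \in ball E X.
Proof. by rewrite inE => ->. Qed.

Lemma ball_adj E (X : {set V}) x y : x \in X -> adj E x y -> y \in ball E X.
Proof.
move=> xX /andP[_ xyE]; rewrite inE; apply/orP; right; apply/bigcupP.
exists [set x; y]; last by rewrite !inE eqxx orbT.
by rewrite inE xyE; apply/pred0Pn; exists x; rewrite /= !inE eqxx.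
Qed.

(** Switching preserves the degrees of [a] and [b], raises those of [u] and [v], and gains one edge
    when both new pairs are absent from [E]. *)
Definition switch E (u v a b : V) :=
  [set u; a] |: ([set v; b] |: (E :\ [set a; b])).

Lemma set2_eq (x y z t : V) : [set x; y] = [set z; t] ->
  x = z /\ y = t \/ x = t /\ y = z.
Proof.
move=> e; have : x \in [set z; t] by rewrite -e !inE eqxx.
have : y \in [set z; t] by rewrite -e !inE eqxx orbT.
have : z \in [set x; y] by rewrite e !inE eqxx.
have : t \in [set x; y] by rewrite e !inE eqxx orbT.
by rewrite !inE => /orP[]/eqP? /orP[]/eqP? /orP[]/eqP? /orP[]/eqP?; subst; auto.
Qed.

Lemma adj_switch E u v a b x y : adj (switch E u v a b) x y ->
  [\/ [/\ adj E x y, ~ (x = a /\ y = b) & ~ (x = b /\ y = a)],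
      (x = u /\ y = a) \/ (x = a /\ y = u) |
      (x = v /\ y = b) \/ (x = b /\ y = v)].
Proof.
rewrite /adj !inE => /andP[xy /or3P[/eqP/set2_eq|/eqP/set2_eq|/andP[nab xyE]]].
- by constructor 2.
- by constructor 3.
- constructor 1; rewrite xy xyE; split=> // -[ex ey]; move: nab; rewrite ex ey ?eqxx //.
  by rewrite setUC eqxx.
Qed.

(** Distance at least 4, unfolded into the absence of walks of lengths 0 to 3. *)
Definition far E x y := [/\ x <> y, ~ adj E x y,
  forall z, adj E x z -> adj E z y -> False &
  forall z w, adj E x z -> adj E z w -> adj E w y -> False].

Lemma far_ball E (X : {set V}) x y :
  x \notin ball E (ball E (ball E X)) -> y \in X -> far E x y.
Proof.
move=> /negP xX yX; split=> [exy|xy|z xz zy|z w xz zw wy]; apply: xX.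
- by rewrite exy; do 3 apply: ball_sub.
- by do 2 apply: ball_sub; apply: (ball_adj yX); rewrite adj_sym.
- apply: ball_sub; apply: (@ball_adj _ _ z); last by rewrite adj_sym.
  by apply: (ball_adj yX); rewrite adj_sym.
- apply: (@ball_adj _ _ z); last by rewrite adj_sym.
  apply: (@ball_adj _ _ w); last by rewrite adj_sym.
  by apply: (ball_adj yX); rewrite adj_sym.
Qed.

Definition switchable E u v a b :=
  adj E a b /\ [/\ far E a u, far E a v, far E b u & far E b v].

(** Exchanging [u, a] with [v, b] lets cycles through [vb] be treated as cycles through [ua]. *)
Lemma switchableC E u v a b : switchable E u v a b -> switchable E v u b a.
Proof. by case=> ab [au av bu bv]; split; rewrite ?(adj_sym _ b). Qed.

Lemma switchC E u v a b : switch E v u b a = switch E u v a b.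
Proof. by rewrite /switch setUCA [[set b; a]]setUC. Qed.

Lemma adjxx E x : adj E x x = false.
Proof. by rewrite /adj eqxx. Qed.

Lemma adj_switch_a E u v a b y : switchable E u v a b ->
  adj (switch E u v a b) a y -> y <> u -> adj E a y /\ y <> b.
Proof.
case=> ab [[au _ _ _] [av _ _ _] _ _] /adj_switch[[ay nb _]|[[]|[]]|[[]|[]]] //.
  by move=> _; split=> // yb; apply: nb.
by move=> ab'; rewrite ab' adjxx in ab.
Qed.

Lemma no_new_triangle E u v a b y : switchable E u v a b ->
  adj (switch E u v a b) a y -> adj (switch E u v a b) y u -> False.
Proof.
move=> sw ay yu; have yu' : y <> u by move=> e; rewrite e adjxx in yu.
have [ay' yb] := adj_switch_a sw ay yu'.
case: sw => ab [[au _ au2 _] [av _ _ _] [bu _ _ _] _].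
move/adj_switch: yu => [[/(au2 _ ay')]|[[]|[ya _]]|[[_ /esym]|[]]] //.
by rewrite ya adjxx in ay'.
Qed.

(** The rest of a 4-cycle through [ua] would be an old walk of length 3 from [a] to [u]. The
    exception is [u = v] with [z = b], where [a, y, b] would be an old triangle. *)
Lemma no_new_quadrangle E u v a b y z : girth5 E -> switchable E u v a b ->
  y <> u -> z <> a -> adj (switch E u v a b) a y -> adj (switch E u v a b) y z ->
  adj (switch E u v a b) z u -> False.
Proof.
move=> [_ _ noC3 _] sw yu za ay yz zu.
have [ay' yb] := adj_switch_a sw ay yu.
case: sw => ab [[au _ au2 au3] [av av1 _ _] [bu _ _ _] _].
have yz' : adj E y z.
  case/adj_switch: yz => [[]|[[]|[ya _]]|[[yv _]|[]]] //.
    by rewrite ya adjxx in ay'.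
  by case: av1; rewrite -yv.
case/adj_switch: zu => [[/(au3 _ _ ay' yz')]|[[_ /esym]|[]]|[[_ /esym]|[zb _]]] //.
by apply: (noC3 a y b) => //; rewrite ?(adj_sym _ b) // -zb.
Qed.

Lemma switch_girth5 E u v a b : girth5 E -> switchable E u v a b ->
  (forall w, #|[set e in E | w \in e]| + (w == u) + (w == v) <= k) ->
  girth5 (switch E u v a b).
Proof.
move=> gE sw deg; have [E2 Ek noC3 noC4] := gE; have sw' := switchableC sw.
pose E' := switch E u v a b.
(* A short cycle with a new edge can be rotated so that this edge comes first; its two orientations
   and the two new edges give four cases. *)
have tri x y z : (x = u /\ y = a \/ x = a /\ y = u) \/
    (x = v /\ y = b \/ x = b /\ y = v) ->
    adj E' y z -> adj E' z x -> False.
  move=> h yz zx; have zy := yz; have xz := zx.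
  rewrite adj_sym in zy; rewrite adj_sym in xz.
  move: h yz zx zy xz => [[]|[]] [-> ->] yz zx zy xz.
  - exact: no_new_triangle sw yz zx.
  - exact: no_new_triangle sw xz zy.
  - by apply: (no_new_triangle sw' (y := z)); rewrite switchC.
  - by apply: (no_new_triangle sw' (y := z)); rewrite switchC.
have quad x y z w : (x = u /\ y = a \/ x = a /\ y = u) \/
    (x = v /\ y = b \/ x = b /\ y = v) -> x != z -> y != w ->
    adj E' y z -> adj E' z w -> adj E' w x -> False.
  move=> h /eqP xz /eqP yw ayz azw awx; have ayz' := ayz; have azw' := azw.
  have awx' := awx; rewrite adj_sym in ayz'; rewrite adj_sym in azw'.
  rewrite adj_sym in awx'; move: h xz yw ayz azw awx ayz' azw' awx'.
  move=> [[]|[]] [-> ->] xz yw ayz azw awx ayz' azw' awx'.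
  - by apply: (no_new_quadrangle gE sw _ _ ayz azw awx) => e; [apply: xz|apply: yw].
  - by apply: (no_new_quadrangle gE sw _ _ awx' azw' ayz') => e; [apply: yw|apply: xz].
  - by apply: (no_new_quadrangle gE sw' (y := z) (z := w)); rewrite 1?switchC // => e;
      [apply: xz|apply: yw].
  - by apply: (no_new_quadrangle gE sw' (y := w) (z := z)); rewrite 1?switchC // => e;
      [apply: yw|apply: xz].
split=> [e|w|x y z xy yz zx|x y z w nxz nyw xy yz zw wx].
- case: sw => _ [[au _ _ _] _ _ [bv _ _ _]].
  rewrite !inE => /or3P[/eqP->|/eqP->|/andP[_ /E2 //]]; rewrite cards2.
    by case: eqP => // e'; case: au.
  by case: eqP => // e'; case: bv.
- have [ab _] := sw; have [/andP[nab abE] _] := sw.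
  have := deg w; rewrite (cardsD1 [set a; b]) !inE abE /=.
  have -> : [set e in E | w \in e] :\ [set a; b] =
      [set e in E :\ [set a; b] | w \in e].
    by apply/setP => e; rewrite !inE andbA.
  have := degreeU1 (E :\ [set a; b]) [set v; b] w.
  have := degreeU1 ([set v; b] |: (E :\ [set a; b])) [set u; a] w.
  rewrite -/(switch E u v a b) !inE.
  (* At [a] and [b] the removal of the edge [ab] pays for the new edge. *)
  have : (w == a) + (w == b) <= ((w == a) || (w == b)).
    by case: (eqVneq w a) => [->|]; rewrite ?(negPf nab) //; case: (w == b).
  move=> hab h1 h2; apply: leq_trans; apply: leq_trans h1 _.
  apply: leq_trans (leq_add (leqnn _) h2) _.
  rewrite addnA [X in _ <= X + _]addnAC [X in _ <= X]addnAC leq_add2r.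
  by move: hab; do 4 case: (w == _).
- case: (adj_switch xy) => [[xy' _ _]|h|h];
    [|exact: tri (or_introl h) yz zx
     |exact: tri (or_intror h) yz zx].
  case: (adj_switch yz) => [[yz' _ _]|h|h];
    [|exact: tri (or_introl h) zx xy
     |exact: tri (or_intror h) zx xy].
  case: (adj_switch zx) => [[zx' _ _]|h|h];
    [|exact: tri (or_introl h) xy yz
     |exact: tri (or_intror h) xy yz].
  exact: noC3 xy' yz' zx'.
- case: (adj_switch xy) => [[xy' _ _]|h|h];
    [|exact: quad (or_introl h) nxz nyw yz zw wx
     |exact: quad (or_intror h) nxz nyw yz zw wx].
  have nzx : z != x by rewrite eq_sym.
  have nwy : w != y by rewrite eq_sym.
  case: (adj_switch yz) => [[yz' _ _]|h|h];
    [|exact: quad (or_introl h) nyw nzx zw wx xy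
     |exact: quad (or_intror h) nyw nzx zw wx xy].
  case: (adj_switch zw) => [[zw' _ _]|h|h];
    [|exact: quad (or_introl h) nzx nwy wx xy yz
     |exact: quad (or_intror h) nzx nwy wx xy yz].
  case: (adj_switch wx) => [[wx' _ _]|h|h];
    [|exact: quad (or_introl h) nwy nxz xy yz zw
     |exact: quad (or_intror h) nwy nxz xy yz zw].
  exact: noC4 nxz nyw xy' yz' zw' wx'.
Qed.

(** The ends of the new edge have no other neighbours, so no cycle passes through it. *)
Lemma add_isolated E p q : girth5 E -> 0 < k -> p != q ->
  p \notin cover E -> q \notin cover E -> girth5 ([set p; q] |: E).
Proof.
move=> [E2 Ek noC3 noC4] k0 pq pE qE; pose E' := [set p; q] |: E.
have iso r x : r \notin cover E -> adj E r x -> False.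
  move=> /negP rE /andP[_ rx]; apply: rE; apply/bigcupP.
  by exists [set r; x]; rewrite ?inE ?eqxx.
have adjE x y : adj E' x y -> [\/ adj E x y, x = p /\ y = q | x = q /\ y = p].
  rewrite /adj !inE => /andP[xy /orP[/eqP/set2_eq[]|xyE]].
  - by constructor 2.
  - by constructor 3.
  - by constructor 1; rewrite xy.
have back x y z : x = p /\ y = q \/ x = q /\ y = p -> adj E' y z -> z = x.
  case=> -[-> ->] /adjE[|[]|[]] //.
  - by move/iso => /(_ qE).
  - by move=> e; rewrite e eqxx in pq.
  - by move/iso => /(_ pE).
  - by move=> e; rewrite e eqxx in pq.
have tri x y z : x = p /\ y = q \/ x = q /\ y = p ->
    adj E' y z -> adj E' z x -> False.
  by move=> h /(back _ _ _ h) ->; rewrite adjxx.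
split=> [e|w|x y z xy yz zx|x y z w nxz nyw xy yz zw wx].
- by rewrite inE => /orP[/set1P->|/E2 //]; rewrite cards2 pq.
- apply: leq_trans (degreeU1 _ _ _) _.
  have [wpq|_] := boolP (w \in [set p; q]); last by rewrite add0n.
  rewrite (_ : [set e in E | w \in e] = set0) ?cards0 ?addn0 //.
  apply/setP => e; rewrite !inE; apply/negP => /andP[eE we].
  have wE : w \in cover E by apply/bigcupP; exists e.
  by move: wpq pE qE; rewrite !inE => /orP[]/eqP <-; rewrite wE.
- case: (adjE _ _ xy) => [xy'|h|h];
    [|exact: tri (or_introl h) yz zx
     |exact: tri (or_intror h) yz zx].
  case: (adjE _ _ yz) => [yz'|h|h];
    [|exact: tri (or_introl h) zx xy
     |exact: tri (or_intror h) zx xy].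
  case: (adjE _ _ zx) => [zx'|h|h];
    [|exact: tri (or_introl h) xy yz
     |exact: tri (or_intror h) xy yz].
  exact: noC3 xy' yz' zx'.
- have quad x' y' z' : x' != z' -> x' = p /\ y' = q \/ x' = q /\ y' = p ->
      adj E' y' z' -> False.
    by move=> n h /(back _ _ _ h) e; rewrite e eqxx in n.
  have nzx : z != x by rewrite eq_sym.
  have nwy : w != y by rewrite eq_sym.
  case: (adjE _ _ xy) => [xy'|h|h];
    [|exact: quad nxz (or_introl h) yz
     |exact: quad nxz (or_intror h) yz].
  case: (adjE _ _ yz) => [yz'|h|h];
    [|exact: quad nyw (or_introl h) zw
     |exact: quad nyw (or_intror h) zw].
  case: (adjE _ _ zw) => [zw'|h|h];
    [|exact: quad nzx (or_introl h) wx
     |exact: quad nzx (or_intror h) wx].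
  case: (adjE _ _ wx) => [wx'|h|h];
    [|exact: quad nwy (or_introl h) xy
     |exact: quad nwy (or_intror h) xy].
  exact: noC4 nxz nyw xy' yz' zw' wx'.
Qed.

(** With few edges two vertices are still uncovered and can be joined. With many, some edge avoids
    the ball of radius 3 around two deficient vertices and can be switched. *)
Lemma graph_step E : girth5 E -> 0 < k -> 2 * #|E| + 2 <= k * #|V| ->
  4 * k * (2 * k).+1 ^ 3 + 2 <= #|V| -> exists2 E', girth5 E' & #|E'| = #|E|.+1.
Proof.
move=> gE k0 room large; have [E2 Ek _ _] := gE.
have [sparse|dense] := leqP (2 * #|E| + 2) #|V|.
  have small : #|cover E| <= 2 * #|E|.
    apply: leq_trans (card_bigcup_leq _ _) _; rewrite mulnC -sum_nat_const.
    by apply: leq_sum => e /E2 ->.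
  have : 1 < #|~: cover E|.
    by rewrite -(leq_add2l #|cover E|) cardsC; apply: leq_trans sparse; rewrite leq_add2r.
  case/card_gt1P => p [q [pE qE pq]]; rewrite !inE in pE qE.
  exists ([set p; q] |: E); first exact: add_isolated.
  rewrite cardsU1 (_ : [set p; q] \notin E) //; apply: contra pE => pqE.
  by apply/bigcupP; exists [set p; q]; rewrite ?inE ?eqxx.
have lt1 : \sum_v #|[set e in E | v \in e]| < k * #|V|.
  by rewrite sum_degree //; apply: leq_trans room; rewrite addn2.
have [u _ uk] := deficient Ek lt1.
(* Counting [u] once more allows [v = u] only if its degree is at most [k - 2]. *)
have lt2 : \sum_v (#|[set e in E | v \in e]| + (v == u)) < k * #|V|.
  rewrite big_split /= sum_degree // -big_mkcond /= big_pred1_eq.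
  by apply: leq_trans room; rewrite addn1 addn2.
have [v _ vk] := deficient uk lt2.
pose B := ball E (ball E (ball E [set u; v])).
(* Three balls around at most two points give [#|B| <= 2 * (2 * k).+1 ^ 3], while [large] and
   [dense] make [#|E|] exceed [k] times this. *)
have cB : k * #|B| < #|E|.
  have h1 := card_ball (ball E (ball E [set u; v])) gE.
  have h2 := card_ball (ball E [set u; v]) gE.
  have h3 := card_ball [set u; v] gE.
  have c2 : #|[set u; v]| <= 2 by rewrite cards2; case: (_ != _).
  have : #|B| <= (2 * k).+1 ^ 3 * 2.
    rewrite 2!expnS expn1 -!mulnA; apply: leq_trans h1 _; rewrite leq_mul2l /=.
    by apply: leq_trans h2 _; rewrite leq_mul2l /=; apply: leq_trans h3 _; rewrite leq_mul2l c2.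
  move=> /(leq_mul (leqnn k)); have := leq_ltn_trans large dense.
  by move: (_ ^ 3) => c; lia.
have [e eE eB] : exists2 e, e \in E & [disjoint e & B].
  have /subsetPn[e eE eB] : ~~ (E \subset incident E B).
    apply: contraL (leq_ltn_trans (card_incident B gE) cB) => /subset_leq_card.
    by rewrite -leqNgt.
  by exists e => //; move: eB; rewrite inE eE /= negbK.
have /cards2P[a [b [nab eab]]] : #|e| == 2 by rewrite E2.
have ab : adj E a b by rewrite /adj nab -eab.
have aB : a \notin B by rewrite (disjointFr eB) // eab !inE eqxx.
have bB : b \notin B by rewrite (disjointFr eB) // eab !inE eqxx orbT.
have sw : switchable E u v a b.
  by split=> //; split; apply: far_ball; 
    first [exact: aB | exact: bB | by rewrite !inE eqxx ?orbT].
exists (switch E u v a b); first exact: switch_girth5.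
have [_ [[au au1 _ _] [av _ _ _] _ [bv bv1 _ _]]] := sw.
have vbE : [set v; b] \notin E :\ [set a; b].
  apply/negP; rewrite inE => /andP[_ vbE]; apply: bv1.
  by rewrite /adj setUC vbE andbT; apply/eqP.
have uaE : [set u; a] \notin [set v; b] |: (E :\ [set a; b]).
  apply/negP; rewrite !inE => /orP[/eqP/set2_eq[]|/andP[_ uaE]].
  - by case=> _ e'; rewrite e' eqxx in nab.
  - by case=> _ /av.
  - by apply: au1; rewrite /adj setUC uaE andbT; apply/eqP.
rewrite /switch !cardsU1 vbE uaE (cardsD1 [set a; b] E) -eab eE.
by rewrite !add1n.
Qed.

Lemma graph_exists j : 0 < k -> 2 * j <= k * #|V| ->
  4 * k * (2 * k).+1 ^ 3 + 2 <= #|V| -> exists2 E, girth5 E & #|E| = j.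
Proof.
move=> k0 + large; elim: j => [|j IH] room.
  exists set0; last by rewrite cards0.
  split=> [e|v|a b c|a b c d _ _]; rewrite ?inE // /adj ?inE ?andbF //.
  by rewrite (_ : [set _ in _ | _] = set0) ?cards0 //; apply/setP => e; rewrite !inE.
have [E gE Ej] := IH ltac:(lia).
by have := graph_step gE k0; rewrite Ej; apply => //; lia.
Qed.

End Graph.

(** * The code formed by the edges of a graph and possibly the empty set *)

Section GraphCode.
Variables (V X : finType) (k : nat) (E : {set {set V}}) (S : X -> {set V}).
Hypothesis gE : girth5 k E.
Hypothesis SE : forall x, S x != set0 -> S x \in E.
Hypothesis S_inj : injective S.

(** Sets of equal size cannot be properly nested, so [f] and [g] each contain exactly one end of
    [e], giving the path [p', p, q, q']. The hypotheses on [f] and [g] admit the empty set, which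
    may be a value of [S]. *)
Lemma edge_cover e f g : e \in E -> (f != set0 -> f \in E) -> (g != set0 -> g \in E) ->
  e \subset f :|: g -> e != f -> e != g ->
  exists p q p' q', [/\ e = [set p; q], f = [set p; p'] & g = [set q; q']] /\
    [/\ adj E p q, adj E p p', adj E q q', p' != q & q' != p].
Proof.
have [E2 _ _ _] := gE => eE fE gE' sub nf ng.
have end2 r (h : {set V}) : (h != set0 -> h \in E) -> r \in h ->
    exists2 r', h = [set r; r'] & adj E r r'.
  move=> hE rh; have h0 : h != set0 by apply/set0Pn; exists r.
  have /cards2P[x [y [xy hxy]]] : #|h| == 2 by rewrite E2 ?hE.
  move: (rh) (hE h0); rewrite hxy !inE => /orP[]/eqP -> hxyE.
    by exists y => //; rewrite /adj xy hxyE.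
  by exists x; [rewrite setUC | rewrite /adj eq_sym xy setUC].
have nsub h : (h != set0 -> h \in E) -> e != h -> ~~ (e \subset h).
  move=> hE; apply: contra => eh; rewrite eqEcard eh (E2 _ eE).
  have [h0|/hE/E2 -> //] := eqVneq h set0.
  by move: eh; rewrite h0 subset0 => /eqP e0; have := E2 _ eE; rewrite e0 cards0.
have [q qe qf] := subsetPn (nsub f fE nf); have [p pe pg] := subsetPn (nsub g gE' ng).
have qg : q \in g by have := subsetP sub q qe; rewrite inE (negPf qf).
have pf : p \in f by have := subsetP sub p pe; rewrite inE (negPf pg) orbF.
have pq : p != q by apply: contraNneq qf => <-.
have epq : e = [set p; q].
  apply/esym/eqP; rewrite eqEcard cards2 pq (E2 _ eE) leqnn andbT.
  by rewrite subUset !sub1set pe qe.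
have [p' fp pp'] := end2 p f fE pf; have [q' gq qq'] := end2 q g gE' qg.
exists p, q, p', q'; split; split=> //.
- by rewrite /adj pq -epq.
- by apply: contraNneq qf => <-; rewrite fp !inE eqxx orbT.
- by apply: contraNneq pg => <-; rewrite gq !inE eqxx orbT.
Qed.

(* The edge [S x] lies in the union of two other edges, so it is the middle of
   a path of length 3 whose ends are joined by [S y]: a 4-cycle. *)
Lemma graph_separates (D1 D2 : {set X}) x : #|D1| = 2 -> #|D2| = 2 ->
  response S D1 = response S D2 -> x \in D1 -> x \notin D2 -> S x = set0.
Proof.
have [E2 _ noC3 noC4] := gE => d1 d2 eD x1 x2; apply/eqP; apply: contraT => Sx0.
have /cards2P[u [v [uv D2uv]]] : #|D2| == 2 by rewrite d2.
have [y D1xy] : exists y, D1 = [set x; y].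
  have /cards2P[z [y [_ D1zy]]] : #|D1| == 2 by rewrite d1.
  by move: x1; rewrite D1zy !inE => /orP[]/eqP->; [exists y | exists z; rewrite setUC].
move: eD; rewrite D1xy D2uv !responseU !response1 => eD.
have neS w : w \in D2 -> S x != S w.
  by move=> wD; rewrite (inj_eq S_inj); apply: contraNneq x2 => ->.
have [p [q [p' [q' [[ex eu ev] [pq pp' qq' p'q q'p]]]]]] :
    exists p q p' q', [/\ S x = [set p; q], S u = [set p; p'] & S v = [set q; q']] /\
    [/\ adj E p q, adj E p p', adj E q q', p' != q & q' != p].
  apply: edge_cover; rewrite -?eD ?subsetUl //; try exact: SE.
    by apply: neS; rewrite D2uv !inE eqxx.
  by apply: neS; rewrite D2uv !inE eqxx orbT.
have p'p : p' != p by case/andP: pp'; rewrite eq_sym.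
have q'q : q' != q by case/andP: qq'; rewrite eq_sym.
have p'y : p' \in S y.
  have : p' \in S x :|: S y by rewrite eD eu !inE eqxx orbT.
  by rewrite ex !inE (negPf p'p) (negPf p'q).
have q'y : q' \in S y.
  have : q' \in S x :|: S y by rewrite eD ev !inE eqxx !orbT.
  by rewrite ex !inE (negPf q'p) (negPf q'q).
have q'p' : q' != p'.
  by apply/eqP => e; apply: (noC3 p q q') => //; rewrite e adj_sym.
have Sy : S y = [set q'; p'].
  have yE : S y \in E by apply: SE; apply/set0Pn; exists p'.
  apply/esym/eqP; rewrite eqEcard cards2 q'p' (E2 _ yE) leqnn andbT.
  by rewrite subUset !sub1set p'y q'y.
have yE : adj E q' p'.
  by rewrite /adj q'p' -Sy SE //; apply/set0Pn; exists p'.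
case: (noC4 p q q' p') => //; last by rewrite adj_sym.
- by rewrite eq_sym.
- by rewrite eq_sym.
Qed.

(** If [D1] and [D2] differ, each has an element outside the other; both are sent to the empty set,
    against injectivity. *)
Lemma graph_code : code 2 k S.
Proof.
split=> [v|D1 D2 d1 d2 eD].
  have [_ Ek _ _] := gE; apply: leq_trans (Ek v).
  rewrite -(card_imset _ S_inj); apply/subset_leq_card/subsetP => _ /imsetP[x vx ->].
  move: vx; rewrite !inE => vx; rewrite vx andbT; apply: SE.
  by apply/set0Pn; exists v.
apply/eqP/negPn/negP => nD.
have /subsetPn[x x1 x2] : ~~ (D1 \subset D2).
  by apply: contra nD => s; rewrite eqEcard s d1 d2.
have /subsetPn[y y2 y1] : ~~ (D2 \subset D1).
  by apply: contra nD => s; rewrite eq_sym eqEcard s d1 d2.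
have Sx := graph_separates d1 d2 eD x1 x2.
have Sy := graph_separates d2 d1 (esym eD) y2 y1.
by move: x2; rewrite (S_inj (etrans Sx (esym Sy))) y2.
Qed.

End GraphCode.

(** * Bounds on q *)

Lemma q2_lower n k : 2 <= k -> 3 <= n -> 2 * n.-1 <= q n 2 k * k.
Proof.
move=> k2 n3; have [S codeS] := @q_code n 2 k (ltnW k2).
have := @code2_bound k _ _ S k2; rewrite !cardsT !card_ord; apply=> //.
  by case: codeS.
exact: code2_cancel codeS.
Qed.

Lemma q2_upper n k m : 0 < k -> 2 * n <= k * m ->
  4 * k * (2 * k).+1 ^ 3 + 2 <= m -> q n.+1 2 k <= m.
Proof.
move=> k0 nm m_large.
have [] := @graph_exists 'I_m k n k0; rewrite ?card_ord // => E gE En.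
(* There are only [n] edges: the last element receives the default [set0], which accounts for
   [n - 1] in the formula. *)
pose S (x : 'I_n.+1) := nth set0 (enum E) x.
have sE : size (enum E) = n by rewrite -cardE.
have ltS x : S x != set0 -> x < n.
  by apply: contraNT; rewrite -leqNgt => le; rewrite /S nth_default ?sE.
have SE x : S x != set0 -> S x \in E.
  by move/ltS => lt; rewrite -mem_enum mem_nth ?sE.
have [E2 _ _ _] := gE.
have S0 (x : 'I_n.+1) : x < n -> S x != set0.
  move=> lt; rewrite -cards_eq0 E2 //.
  by rewrite -mem_enum mem_nth ?sE.
have S_inj : injective S.
  move=> x y exy; apply: val_inj => /=.
  have [lx|gx] := ltnP x n.
    have ly : y < n by apply: ltS; rewrite -exy S0.
    by apply/eqP; rewrite -(nth_uniq set0 _ _ (enum_uniq E)) ?sE //; apply/eqP.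
  have gy : n <= y.
    by rewrite leqNgt; apply: contraL gx => /S0; rewrite -exy -ltnNge; apply: ltS.
  by have := ltn_ord x; have := ltn_ord y; lia.
by have := q_le_code k0 (graph_code gE SE S_inj); rewrite card_ord.
Qed.

Lemma q3_lower n k : 0 < k -> 5 <= n -> 3 * n - 2 <= q n 3 k * (k + 3).
Proof.
move=> k0 n5; have [S codeS] := @q_code n 3 k k0.
have := @code3_bound k _ _ S; rewrite !cardsT !card_ord; apply=> //.
  by case: codeS.
exact: code3_cancel codeS.
Qed.

Lemma q3_upper n k M : 0 < k -> n <= M * k ->
  (2 * (k + 2 * k * k ^ 2) + 1) ^ 3 <= M -> q n 3 k <= 3 * M.
Proof.
move=> k0 nM M_large.
have I_lt (x : 'I_n) : x %/ k < M.
  by rewrite ltn_divLR // (leq_trans (ltn_ord x)).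
have J_lt (x : 'I_n) : x %% k < k by rewrite ltn_pmod.
have IJ_inj (x y : 'I_n) : x %/ k = y %/ k -> x %% k = y %% k -> x = y.
  by move=> eI eJ; apply: val_inj; rewrite /= (divn_eq x k) (divn_eq y k) eI eJ.
have := q_le_code k0 (grid_code k0 M_large I_lt J_lt IJ_inj).
(* ['Z_M] has [M] elements only if [1 < M]. *)
rewrite card_prod !card_ord Zp_cast //.
by apply: leq_trans M_large; rewrite -[X in X < _](exp1n 3) ltn_exp2r //; nia.
Qed.

Local Open Scope ring_scope.

Lemma ceil_nat (x : rat) : 0 <= x -> exists2 m : nat, Num.ceil x = m%:Z & x <= m%:R.
Proof.
move=> x0; have : 0 <= Num.ceil x by rewrite ceil_ge0 (lt_le_trans _ x0).
by have := ceil_ge x; case: (Num.ceil x) => // m xm _; exists m.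
Qed.

Theorem theorem5 (k : nat) (k_gt0 : (0 < k)%N) :
  exists N : nat, forall n : nat, (N <= n)%N -> (k <= n)%N ->
    ((2 <= k)%N ->
       (q n 2 k)%:Z = Num.ceil (2 * (n%:R - 1) / k%:R : rat))
    /\ (Num.ceil ((3 * n%:R - 2) / (k%:R + 3) : rat) <= (q n 3 k)%:Z
        /\ (q n 3 k)%:Z <= Num.ceil (3 * n%:R / k%:R : rat) + 2).
Proof.
have [N2 up2] : exists N2, forall n m,
    (2 * n <= k * m)%N -> (N2 <= m)%N -> (q n.+1 2 k <= m)%N.
  by eexists => n m nm; apply: q2_upper nm.
have [N3 up3] : exists N3, forall n M,
    (n <= M * k)%N -> (N3 <= M)%N -> (q n 3 k <= 3 * M)%N.
  by eexists => n M nM; apply: q3_upper nM.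
have kR : 0 < k%:R :> rat by rewrite ltr0n.
(* After division by [k] this exceeds both thresholds on the number of queries or lines; the 5
   serves the lower bounds. *)
exists (k * (N2 + N3) + 5)%N => n n_large _.
have n5 : (5 <= n)%N by lia.
have n1 : n%:R - 1 = n.-1%:R :> rat by rewrite -subn1 natrB //; lia.
split=> [k2|].
  have : Num.ceil (2 * (n%:R - 1) / k%:R : rat) <= (q n 2 k)%:Z.
    rewrite ceil_le_int ler_pdivrMr // n1 -!natrM ler_nat.
    exact: q2_lower k2 (leq_trans _ n5).
  have [m -> ] : exists2 m : nat, Num.ceil (2 * (n%:R - 1) / k%:R : rat) = m%:Z &
      2 * (n%:R - 1) / k%:R <= m%:R :> rat.
    by apply: ceil_nat; rewrite n1 divr_ge0 ?mulr_ge0 ?ler0n.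
  rewrite n1 ler_pdivrMr // -!natrM ler_nat => nm lower.
  have upper : (q n 2 k <= m)%N.
    rewrite -(@prednK n) //; last by lia.
    apply: up2; first by rewrite [(k * m)%N]mulnC.
    by rewrite -(leq_pmul2l k_gt0); nia.
  by apply/eqP; rewrite eq_le lez_nat upper.
split.
  rewrite ceil_le_int ler_pdivrMr; last by rewrite -natrD ltr0n addn3.
  have := q3_lower k_gt0 n5.
  rewrite -(ler_nat rat) natrB ?natrM ?natrD; last by lia.
  by [].
have [m -> ] : exists2 m : nat, Num.ceil (3 * n%:R / k%:R : rat) = m%:Z &
    3 * n%:R / k%:R <= m%:R :> rat.
  by apply: ceil_nat; rewrite divr_ge0 ?mulr_ge0 ?ler0n.
rewrite ler_pdivrMr // -!natrM ler_nat => nm.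
(* The ceiling of [n / k]. *)
pose M := ((n + k.-1) %/ k)%N.
have le_nM : (n <= M * k)%N.
  by have := divn_eq (n + k.-1) k; have := ltn_pmod (n + k.-1) k_gt0; rewrite -/M; lia.
have le_Mn : (M * k <= n + k.-1)%N by apply: leq_divM.
have M_large : (N3 <= M)%N.
  by rewrite -(leq_pmul2r k_gt0); apply: leq_trans le_nM; nia.
have := up3 _ _ le_nM M_large.
(* Here [3 * M * k <= 3 * n + 3 * (k - 1) < (m + 3) * k]: rounding up each of the three partitions
   costs the additive 2. *)
have : (3 * M <= m + 2)%N.
  by rewrite -ltnS -(ltn_pmul2r k_gt0); lia.
by lia.
Qed.
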